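(* Let $\mathcal{L}$ be an intuitionistic abstract logic and $a,b\in Expr_{\mathcal{L}}$. For every theory $T\in Th_{\mathcal{L}}$: (a) $a,b\in T$ iff $a\wedge b\in T$; (b) if $a\in T$ or $b\in T$ then $a\vee b\in T$, and the converse holds when $T$ is prime; (c) if $a\in T$ and $a\to b\in T$ then $b\in T$; (d) if $P\in PTh_{\mathcal{L}}$ is a prime theory, then $a\to b\in P$ iff for every prime theory $Q\supseteq P$, $a\in Q$ implies $b\in Q$.
   Context: An abstract logic is a triple $\mathcal{L}=(Expr_{\mathcal{L}},Th_{\mathcal{L}},\mathcal{C}_{\mathcal{L}})$ where $Expr_{\mathcal{L}}$ is a set, $Th_{\mathcal{L}}$ a non-empty set of subsets of $Expr_{\mathcal{L}}$ (theories) with $\bigcap\mathcal{T}\in Th_{\mathcal{L}}$ for every non-empty $\mathcal{T}\subseteq Th_{\mathcal{L}}$, and $\mathcal{C}_{\mathcal{L}}$ a set of operations on $Expr_{\mathcal{L}}$. $\mathcal{L}$ is closed under union of chains if the union of every non-empty chain of theories is a theory. A theory $T$ is prime if $T=\bigcap\mathcal{T}$ for a non-empty finite $\mathcal{T}\subseteq Th_{\mathcal{L}}$ implies $T\in\mathcal{T}$; totally prime if this holds for every non-empty $\mathcal{T}$ of any cardinality. $PTh_{\mathcal{L}}$, $TPTh_{\mathcal{L}}$ denote the sets of prime and totally prime theories. An intuitionistic abstract logic is an abstract logic closed under union of chains with binary connectives $\vee,\wedge,\to$ and constants $\top,\bot$ such that for all $a,b\in Expr_{\mathcal{L}}$ and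 all $T\in TPTh_{\mathcal{L}}$: $a\vee b\in T$ iff $a\in T$ or $b\in T$; $a\wedge b\in T$ iff $a\in T$ and $b\in T$; $a\to b\in T$ iff for every totally prime $T'\supseteq T$, $a\in T'$ implies $b\in T'$; $\top$ lies in every theory and $\bot$ in no theory. *)

(* Defs.v *)
(* Sets of expressions are predicates [Expr -> Prop];
   equality of theories is Leibniz equality of predicates (with functional and
   propositional extensionality, which are whitelisted, this is set equality). *)
From Stdlib Require Import List.
Set Implicit Arguments.

Definition bigcap {E : Type} (F : (E -> Prop) -> Prop) : E -> Prop :=
  fun x => forall T, F T -> T x.

Definition bigcup {E : Type} (F : (E -> Prop) -> Prop) : E -> Prop :=
  fun x => exists T, F T /\ T x.

Definition subset {E : Type} (A B : E -> Prop) : Prop := forall x, A x -> B x.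

(* Abstract logic (Expr, Th, C); the operations C are recorded in
   [intuitionistic_logic] below as the specific connectives needed. *)
Record abstract_logic := {
  Expr : Type;
  Th : (Expr -> Prop) -> Prop;
  Th_nonempty : exists T, Th T;
  Th_inter : forall F : (Expr -> Prop) -> Prop,
      (exists T, F T) -> (forall T, F T -> Th T) -> Th (bigcap F)
}.

Definition is_chain {E : Type} (F : (E -> Prop) -> Prop) : Prop :=
  forall T1 T2, F T1 -> F T2 -> subset T1 T2 \/ subset T2 T1.

Definition closed_under_union_of_chains (L : abstract_logic) : Prop :=
  forall F : (Expr L -> Prop) -> Prop,
    (exists T, F T) -> (forall T, F T -> Th L T) -> is_chain F -> Th L (bigcup F).

(* Prime theory: T = ⋂ 𝒯 for a non-empty finite 𝒯 ⊆ Th implies T ∈ 𝒯.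
   Finite families are given by a (non-empty) list enumerating them. *)
Definition prime_theory (L : abstract_logic) (T : Expr L -> Prop) : Prop :=
  Th L T /\
  forall l : list (Expr L -> Prop),
    l <> nil -> (forall T', In T' l -> Th L T') ->
    T = bigcap (fun T' => In T' l) -> In T l.

Definition totally_prime_theory (L : abstract_logic) (T : Expr L -> Prop) : Prop :=
  Th L T /\
  forall F : (Expr L -> Prop) -> Prop,
    (exists T', F T') -> (forall T', F T' -> Th L T') ->
    T = bigcap F -> F T.

Record intuitionistic_logic := {
  IL :> abstract_logic;
  IL_chains : closed_under_union_of_chains IL;
  lor : Expr IL -> Expr IL -> Expr IL;
  land : Expr IL -> Expr IL -> Expr IL;
  limp : Expr IL -> Expr IL -> Expr IL;
  ltop : Expr IL;
  lbot : Expr IL;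
  lor_spec : forall a b T, totally_prime_theory IL T ->
      (T (lor a b) <-> T a \/ T b);
  land_spec : forall a b T, totally_prime_theory IL T ->
      (T (land a b) <-> T a /\ T b);
  limp_spec : forall a b T, totally_prime_theory IL T ->
      (T (limp a b) <-> forall T', totally_prime_theory IL T' -> subset T T' ->
                                   T' a -> T' b);
  ltop_spec : forall T, Th IL T -> T ltop;
  lbot_spec : forall T, Th IL T -> ~ T lbot
}.

(* Main.v *)
(* Lindenbaum's lemma holds in any abstract logic closed under unions of
   chains: by Zorn, a theory T avoiding x extends to a maximal theory avoiding
   x, and such a maximal theory is totally prime.  Hence every theory is the
   intersection of the totally prime theories containing it, and the clauses
   for conjunction, the introduction of disjunction and modus ponens transfer
   from totally prime theories to arbitrary ones.  For a prime theory T
   containing a \/ b, splitting its totally prime extensions into those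
   containing a and those containing b writes T as the intersection of two
   theories, so T is one of them. *)
Require Import Defs.
From Stdlib Require Import List Classical FunctionalExtensionality PropExtensionality.
From mathcomp Require classical_sets.

Set Implicit Arguments.
Unset Strict Implicit.

Lemma set_ext {E : Type} (A B : E -> Prop) : (forall z, A z <-> B z) -> A = B.
Proof.
  intros H; apply functional_extensionality; intros z.
  apply propositional_extensionality, H.
Qed.

Lemma bigcap_pair {E : Type} (A B : E -> Prop) (z : E) :
  bigcap (fun T => In T (A :: B :: nil)) z <-> A z /\ B z.
Proof.
  split.
  - intros H; split; apply H; simpl; auto.
  - intros [Az Bz] T [<- | [<- | []]]; assumption.
Qed.

Section Lindenbaum.

Variable L : intuitionistic_logic.
Variables (T : Expr L -> Prop) (x : Expr L).

Definition avoiding (U : Expr L -> Prop) : Prop := Th L U /\ subset T U /\ ~ U x.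

Lemma bigcup_avoiding (F : (Expr L -> Prop) -> Prop) :
  (exists U, F U) -> (forall U, F U -> avoiding U) -> is_chain F ->
  avoiding (bigcup F).
Proof.
  intros [U FU] HF Hchain.
  split; [| split].
  - apply IL_chains; [exists U; exact FU | | exact Hchain].
    intros V FV; apply HF, FV.
  - intros z Tz; exists U; split; [exact FU | apply (HF U FU), Tz].
  - intros [V [FV Vx]]; apply (HF V FV), Vx.
Qed.

Lemma maximal_avoiding_totally_prime (M : Expr L -> Prop) :
  avoiding M -> (forall V, subset M V -> avoiding V -> subset V M) ->
  totally_prime_theory L M.
Proof.
  intros [ThM [TM Mx]] Hmax; split; [exact ThM |].
  intros F _ HF ->.
  destruct (classic (exists V, F V /\ ~ V x)) as [[V [FV Vx]] | Hall].
  - assert (MV : subset (bigcap F) V) by (intros z Hz; apply Hz, FV).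
    replace (bigcap F) with V; [exact FV |].
    apply set_ext; intros z; split; [| apply MV].
    apply (Hmax V MV); repeat split; auto.
    intros w Tw; apply MV, TM, Tw.
  - exfalso; apply Mx; intros V FV.
    apply NNPP; intros Vx; apply Hall; exists V; auto.
Qed.

(* Zorn is applied to the avoiding theories together with the empty set,
   which serves as the union of the empty chain. *)
Lemma exists_totally_prime_avoiding :
  Th L T -> ~ T x -> exists M, totally_prime_theory L M /\ subset T M /\ ~ M x.
Proof.
  intros ThT Tx.
  set (P := fun U : Expr L -> Prop => (forall y, ~ U y) \/ avoiding U).
  destruct (@classical_sets.Zorn_bigcup (Expr L) P) as [M [PM Hmax]].
  - intros F HF Htot.
    destruct (classic (exists U, F U /\ exists y, U y)) as [[U [FU [y Uy]]] | Hempty].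
    + right.
      set (G := fun V => F V /\ exists y, V y).
      replace (classical_sets.bigcup F (fun X => X)) with (bigcup G).
      * apply bigcup_avoiding.
        -- exists U; split; [exact FU | exists y; exact Uy].
        -- intros V [FV [z Vz]].
           destruct (HF V FV) as [Vempty | HV]; [destruct (Vempty z Vz) | exact HV].
        -- intros V1 V2 [F1 _] [F2 _]; apply Htot; assumption.
      * apply set_ext; intros z; split.
        -- intros [V [[FV _] Vz]]; exists V; assumption.
        -- intros [V FV Vz]; exists V; split; [split; [exact FV | exists z] |]; exact Vz.
    + left; intros y [V FV Vy]; apply Hempty; exists V; split; [| exists y]; assumption.
  - assert (AM : avoiding M).
    { destruct PM as [Mempty | AM]; [exfalso | exact AM].
      apply (Hmax T); [split | right; repeat split; auto; intros z Tz; exact Tz].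
      - intros z Mz; destruct (Mempty z Mz).
      - intros TM; apply (Mempty (ltop L)), TM, ltop_spec, ThT. }
    exists M; split; [| apply AM].
    apply maximal_avoiding_totally_prime; [exact AM |].
    intros V MV AV; apply NNPP; intros VM.
    apply (Hmax V); [split; assumption | right; exact AV].
Qed.

End Lindenbaum.

Section Theories.

Variable L : intuitionistic_logic.

Definition totally_prime_above (T M : Expr L -> Prop) : Prop :=
  totally_prime_theory L M /\ subset T M.

Lemma theory_mem_totally_prime_above (T : Expr L -> Prop) (z : Expr L) :
  Th L T -> (T z <-> forall M, totally_prime_above T M -> M z).
Proof.
  intros ThT; split.
  - intros Tz M [_ TM]; apply TM, Tz.
  - intros H; apply NNPP; intros Tz.
    destruct (exists_totally_prime_avoiding ThT Tz) as [M [HM [TM Mz]]].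
    apply Mz, H; split; assumption.
Qed.

Lemma totally_prime_prime (T : Expr L -> Prop) :
  totally_prime_theory L T -> prime_theory L T.
Proof.
  intros [ThT HT]; split; [exact ThT |].
  intros [| U l] Hl Hth E; [congruence |].
  apply HT; [exists U; simpl; auto | exact Hth | exact E].
Qed.

Lemma prime_theory_inter2 (T A B : Expr L -> Prop) :
  prime_theory L T -> Th L A -> Th L B -> (forall z, T z <-> A z /\ B z) ->
  T = A \/ T = B.
Proof.
  intros [_ HT] ThA ThB E.
  assert (HI : In T (A :: B :: nil)).
  { apply HT; [discriminate | intros V [<- | [<- | []]]; assumption |].
    apply set_ext; intros z; rewrite bigcap_pair; apply E. }
  destruct HI as [<- | [<- | []]]; auto.
Qed.

Variables a b : Expr L.

Lemma theory_land (T : Expr L -> Prop) :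
  Th L T -> (T a /\ T b <-> T (land L a b)).
Proof.
  intros ThT; rewrite !(theory_mem_totally_prime_above _ ThT); split.
  - intros [Ha Hb] M HM; apply (land_spec L a b (proj1 HM)).
    split; [apply Ha | apply Hb]; exact HM.
  - intros H; split; intros M HM; destruct (proj1 (land_spec L a b (proj1 HM)) (H M HM)); assumption.
Qed.

Lemma theory_lor_intro (T : Expr L -> Prop) :
  Th L T -> T a \/ T b -> T (lor L a b).
Proof.
  intros ThT; rewrite !(theory_mem_totally_prime_above _ ThT).
  intros H M HM; apply (lor_spec L a b (proj1 HM)).
  destruct H as [Ha | Hb]; [left; apply Ha | right; apply Hb]; exact HM.
Qed.

Lemma theory_limp_elim (T : Expr L -> Prop) :
  Th L T -> T a -> T (limp L a b) -> T b.
Proof.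
  intros ThT; rewrite !(theory_mem_totally_prime_above _ ThT).
  intros Ha Hab M [HM TM].
  apply (proj1 (limp_spec L a b HM) (Hab M (conj HM TM)) M HM); [| apply Ha; split; auto].
  intros z Mz; exact Mz.
Qed.

Lemma prime_theory_lor_elim (T : Expr L -> Prop) :
  prime_theory L T -> T (lor L a b) -> T a \/ T b.
Proof.
  intros HT Hab.
  pose proof (proj1 HT) as ThT.
  assert (Hsplit : forall M, totally_prime_above T M -> M a \/ M b).
  { intros M [HM TM]; apply (lor_spec L a b HM), TM, Hab. }
  set (Fa := fun M => totally_prime_above T M /\ M a).
  set (Fb := fun M => totally_prime_above T M /\ M b).
  destruct (classic (exists M, Fa M)) as [[Ma FMa] | NoA].
  2:{ right; apply (theory_mem_totally_prime_above _ ThT); intros M HM.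
      destruct (Hsplit M HM); [exfalso; apply NoA; exists M; split |]; assumption. }
  destruct (classic (exists M, Fb M)) as [[Mb FMb] | NoB].
  2:{ left; apply (theory_mem_totally_prime_above _ ThT); intros M HM.
      destruct (Hsplit M HM); [| exfalso; apply NoB; exists M; split]; assumption. }
  assert (ThA : Th L (bigcap Fa))
    by (apply Th_inter; [exists Ma; exact FMa | intros M [[[ThM _] _] _]; exact ThM]).
  assert (ThB : Th L (bigcap Fb))
    by (apply Th_inter; [exists Mb; exact FMb | intros M [[[ThM _] _] _]; exact ThM]).
  assert (E : forall z, T z <-> bigcap Fa z /\ bigcap Fb z).
  { intros z; rewrite (theory_mem_totally_prime_above _ ThT); split.
    - intros Hz; split; intros M [HM _]; apply Hz, HM.
    - intros [Az Bz] M HM.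
      destruct (Hsplit M HM); [apply Az | apply Bz]; split; assumption. }
  destruct (prime_theory_inter2 HT ThA ThB E) as [EA | EB]; [left | right].
  - rewrite EA; intros M [_ Ma']; exact Ma'.
  - rewrite EB; intros M [_ Mb']; exact Mb'.
Qed.

Lemma theory_limp (P : Expr L -> Prop) :
  Th L P ->
  (P (limp L a b) <-> forall Q, prime_theory L Q -> subset P Q -> Q a -> Q b).
Proof.
  intros ThP; split.
  - intros Hab Q [ThQ _] PQ Qa; apply (theory_limp_elim ThQ Qa), PQ, Hab.
  - intros H; apply (theory_mem_totally_prime_above _ ThP); intros M [HM PM].
    apply (limp_spec L a b HM); intros N HN MN Na.
    apply (H N (totally_prime_prime HN)); [intros z Pz; apply MN, PM, Pz | exact Na].
Qed.

End Theories.

Theorem lemma2p7 (L : intuitionistic_logic) (a b : Expr L) :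
  (forall T : Expr L -> Prop, Th L T ->
     ((T a /\ T b) <-> T (land L a b)) /\
     ((T a \/ T b -> T (lor L a b)) /\
      (prime_theory L T -> T (lor L a b) -> T a \/ T b)) /\
     (T a -> T (limp L a b) -> T b)) /\
  (forall P : Expr L -> Prop, prime_theory L P ->
     (P (limp L a b) <->
      forall Q : Expr L -> Prop, prime_theory L Q -> subset P Q -> Q a -> Q b)).
Proof.
  split.
  - intros T ThT; split; [| split; [split |]].
    + apply theory_land, ThT.
    + apply theory_lor_intro, ThT.
    + apply prime_theory_lor_elim.
    + apply theory_limp_elim, ThT.
  - intros P [ThP _]; apply theory_limp, ThP.
Qed.
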